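(* Let $\mathbb X_i$, $i\in I$, be pairwise disjoint, connected and reversible $L_b$-structures, $\mathbb X=\bigcup_{i\in I}\mathbb X_i$ and $\mathcal X=\{\mathbb X_i:i\in I\}$. If there is $\theta\in\mathbb M(\mathcal X)$ such that for each $a\in\theta[\mathcal X]$ there is no $\omega^*$-sequence in $I^\theta_a$, then $\mathbb X$ is reversible. In particular this holds if $\langle\theta(\mathbb X_i):i\in I\rangle$ is finite-to-one, i.e. all sets $I^\theta_a$, $a\in\theta[\mathcal X]$, are finite.
   Context: An $L_b$-structure is a pair $\langle X,\rho\rangle$ with $\rho\subseteq X^2$. A homomorphism preserves the relation; a monomorphism is an injective homomorphism, a condensation a bijective homomorphism. A structure is reversible iff every condensation from it to itself is an automorphism. Components are the classes of the smallest equivalence relation containing $\rho$; connected means exactly one component. The union of disjoint structures is $\langle\bigcup X_i,\bigcup\rho_i\rangle$. Write $\mathbb Y\preccurlyeq_m\mathbb Z$ iff there is a monomorphism $\mathbb Y\to\mathbb Z$. A well founded relation is a pair $\mathcal W=\langle\mathcal A,\mathcal R\rangle$ where $\mathcal A$ is a class and $\mathcal R$ a binary class relation on $\mathcal A$ such that every non-empty set $S\subseteq\mathcal A$ has an $\mathcal R$-minimal element (some $y\in S$ with no $z\in S$, $z\mathcal R y$); write $a\le_{\mathcal R}b$ iff $a=b$ or $a\mathcal R b$. $\mathbb M(\mathcal X,\mathcal W)$ is the class of functions $\theta:\mathcal X\to\mathcal A$ with $\mathbb Y\preccurlyeq_m\mathbb Z\Rightarrow\theta(\mathbb Y)\le_{\mathcal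 R}\theta(\mathbb Z)$ for $\mathbb Y,\mathbb Z\in\mathcal X$, and $\mathbb M(\mathcal X)$ is the union of $\mathbb M(\mathcal X,\mathcal W)$ over all well founded relations $\mathcal W$. For such $\theta$ and $a$, $I^\theta_a=\{i\in I:\theta(\mathbb X_i)=a\}$. An $\omega^*$-sequence in a set $J\subseteq I$ is an injection $k\mapsto i_k$ from $\omega$ to $J$ such that $\mathbb X_{i_l}\preccurlyeq_m\mathbb X_{i_k}$ whenever $k<l$. *)

(* Defs.v *)
From Stdlib Require Import Relation_Operators.
From mathcomp Require Import all_boot.
From mathcomp Require Import boolp classical_sets functions cardinality.

Set Implicit Arguments.
Unset Strict Implicit.
Unset Printing Implicit Defensive.

Local Open Scope classical_set_scope.

(* Structures live on subsets of an ambient type U, so that disjointness and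
   union of a family of structures are literal. *)
Record structure (U : Type) := Structure {
  dom : set U;
  rho : set (U * U);
  rho_sub : rho `<=` dom `*` dom }.

Section Morphisms.
Variable U : Type.
Implicit Types (Y Z : structure U) (f : U -> U).

(* Maps Y -> Z are represented by functions U -> U of which only the values on
   [dom Y] matter. *)
Definition homomorphism Y Z f :=
  set_fun (dom Y) (dom Z) f /\
  forall x y, rho Y (x, y) -> rho Z (f x, f y).

Definition monomorphism Y Z f := homomorphism Y Z f /\ set_inj (dom Y) f.

Definition condensation Y Z f :=
  homomorphism Y Z f /\ set_bij (dom Y) (dom Z) f.

Definition isomorphism Y Z f :=
  set_bij (dom Y) (dom Z) f /\
  forall x y, dom Y x -> dom Y y -> (rho Y (x, y) <-> rho Z (f x, f y)).

Definition automorphism Y f := isomorphism Y Y f.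

Definition reversible Y := forall f, condensation Y Y f -> automorphism Y f.

Definition mono_le Y Z := exists f, monomorphism Y Z f.

Definition component Y (x : U) : set U :=
  [set y | dom Y y /\ clos_refl_sym_trans U (fun u v => rho Y (u, v)) x y].

Definition components Y : set (set U) := component Y @` dom Y.

Definition connected Y := exists C, components Y = [set C].

Definition union_dom (I : Type) (X : I -> structure U) : set U :=
  \bigcup_i dom (X i).

Definition union_rho (I : Type) (X : I -> structure U) : set (U * U) :=
  \bigcup_i rho (X i).

Lemma union_rho_sub (I : Type) (X : I -> structure U) :
  union_rho X `<=` union_dom X `*` union_dom X.
Proof. by move=> p [i _ /rho_sub[h1 h2]]; split; exists i. Qed.

Definition union (I : Type) (X : I -> structure U) : structure U :=
  Structure (@union_rho_sub I X).

Definition pairwise_disjoint (I : Type) (X : I -> structure U) :=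
  trivIset setT (fun i => dom (X i)).

Definition omega_star_seq (I : Type) (X : I -> structure U) (J : set I)
    (s : nat -> I) :=
  [/\ injective s, forall k, J (s k) &
      forall k l, k < l -> mono_le (X (s l)) (X (s k))].

End Morphisms.

Record wf_relation := WfRelation {
  wf_sort :> Type;
  wf_rel : wf_sort -> wf_sort -> Prop;
  wf_min : forall S : set wf_sort, S !=set0 ->
    exists2 y, S y & forall z, S z -> ~ wf_rel z y }.

Definition wf_le (W : wf_relation) (a b : W) := a = b \/ wf_rel a b.

Definition monotone_class (U : Type) (XX : set (structure U)) (W : wf_relation)
    : set (XX -> W) :=
  [set theta | forall Y Z : XX,
    mono_le (set_val Y) (set_val Z) -> wf_le (theta Y) (theta Z)].

Definition family_mem (U I : Type) (X : I -> structure U) (i : I) : range X :=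
  SigSub (mem_set (imageT X i)).

Definition level (U I : Type) (X : I -> structure U) (W : wf_relation)
    (theta : range X -> W) (a : W) : set I :=
  [set i | theta (family_mem X i) = a].

(* Main.v *)
(** A condensation [f] of the union maps each connected [X i] into a single
    [X (g i)], and the index map [g] is surjective. Following preimages under
    [g] from [i] gives a [mono_le]-decreasing sequence; induction along the well
    founded relation shows that it stays inside the level of [i]. Having no
    omega*-sequence there, it repeats, so every index is [g]-periodic. Hence [g]
    is injective, and some iterate of [f] is a condensation, thus an
    automorphism, of [X i]; this makes [f] reflect the relation. *)
Require Import Defs.
From mathcomp Require Import all_boot.
From mathcomp Require Import boolp classical_sets functions cardinality.

Set Implicit Arguments.
Unset Strict Implicit.
Unset Printing Implicit Defensive.

Local Open Scope classical_set_scope.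

(** * Well-founded induction and periodic maps *)

Lemma wf_relation_ind (W : wf_relation) (P : W -> Prop) :
  (forall a, (forall b, wf_rel b a -> P b) -> P a) -> forall a, P a.
Proof.
move=> IH a; apply: contrapT => nPa.
have [|y nPy miny] := @wf_min W [set b | ~ P b]; first by exists a.
by apply: nPy; apply: IH => b Rby; apply: contrapT => /miny; apply.
Qed.

Lemma iter_cancel (T : Type) (g h : T -> T) n :
  cancel h g -> cancel (iter n h) (iter n g).
Proof. by move=> hK; elim: n => // n IHn x; rewrite iterSr iterS hK IHn. Qed.

Lemma iter_fix_mul (T : Type) (g : T -> T) n m x :
  iter n g x = x -> iter (m * n) g x = x.
Proof. by move=> gx; elim: m => //= m IHm; rewrite mulSn iterD IHm. Qed.

(** The product of a period of [x] and one of [y] is a positive common period, so both points are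
    recovered from [g x = g y] by the same further iterate of [g]. *)
Lemma periodic_injective (T : Type) (g : T -> T) :
  (forall x, exists n, iter n.+1 g x = x) -> injective g.
Proof.
move=> per x y gxy; have [n gx] := per x; have [m gy] := per y.
rewrite -(iter_fix_mul m.+1 gx) -[RHS](iter_fix_mul n.+1 gy).
by rewrite (mulnC n.+1) mulSn addSn !iterSr gxy.
Qed.

Section Periodicity.
Variables (T : Type) (le : T -> T -> Prop) (W : wf_relation) (t : T -> W).
Hypothesis le_refl : forall x, le x x.
Hypothesis le_trans : forall x y z, le x y -> le y z -> le x z.
Hypothesis t_mono : forall x y, le x y -> wf_le (t x) (t y).
Hypothesis no_descent : forall a, ~ exists s : nat -> T,
  [/\ injective s, forall k, t (s k) = a & forall k l, k < l -> le (s l) (s k)].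

Lemma increasing_surjection_periodic (g : T -> T) :
  (forall y, exists x, g x = y) -> (forall x, le x (g x)) ->
  forall x, exists n, iter n.+1 g x = x.
Proof.
move=> /choice[h hK] le_g.
(* The second conjunct strengthens the induction: [g] must preserve strictly lower levels for
   backward orbits to stay in the level [a]. *)
suff key a : forall x, t x = a ->
    (exists n, iter n.+1 h x = x) /\ t (g x) = a.
  move=> x; have [[n hx] _] := key _ x erefl.
  by exists n; rewrite -{1}hx iter_cancel.
elim/wf_relation_ind: a => a IH x tx.
have lev k : t (iter k h x) = a.
  (* If the next preimage had a value strictly below [a], the induction hypothesis would make [g]
     preserve that value; but [g] sends this preimage to a point of level [a]. *)
  elim: k => //= k IHk; have := t_mono (le_g (h (iter k h x))).
  rewrite hK IHk => -[//|R].
  by have [_] := IH _ R _ erefl; rewrite hK IHk => <-.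
have le_h k d : le (iter (d + k) h x) (iter k h x).
  elim: d => // d; apply: le_trans; rewrite addSn iterS.
  by have := le_g (h (iter (d + k) h x)); rewrite hK.
have [n hx] : exists n, iter n.+1 h x = x.
  apply: contrapT => nper; apply: (@no_descent a).
  exists (fun k => iter k h x); split => // [k l|k l kl]; last first.
    by rewrite -(subnK (ltnW kl)).
  wlog kl : k l / k < l => [wl hkl|].
    by case: (ltngtP k l) => // lt; [|symmetry]; apply: wl.
  (* Applying the [k]-th iterate of [g] to the collision cancels [k] copies of [h] on both sides,
     leaving the period [l - k]. *)
  move=> hkl; case: nper; exists (l - k.+1).
  by rewrite subnSK // -{2}(iter_cancel k hK x) hkl -{2}(subnKC (ltnW kl))
    iterD iter_cancel.
(* Periodicity turns [g x] into the backward iterate [iter n h x], whose level is known. *)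
by split; [exists n | rewrite -hx iterS hK].
Qed.

End Periodicity.

(** * Monomorphisms, connectedness and iterated condensations *)

Section Morphisms.
Variable U : Type.
Implicit Types (Y Z : structure U) (f : U -> U).

Lemma mono_le_refl Y : mono_le Y Y.
Proof. by exists id; split => //; split. Qed.

Lemma mono_le_trans Y Z T : mono_le Y Z -> mono_le Z T -> mono_le Y T.
Proof.
move=> [f [[fD fR] fI]] [g [[gD gR] gI]]; exists (g \o f); split; first split.
- by move=> x /fD /gD.
- by move=> x y /fR /gR.
- move=> x y xY yY /= e; apply: fI => //; apply: gI => //.
    by rewrite inE; apply: fD; rewrite -inE.
  by rewrite inE; apply: fD; rewrite -inE.
Qed.

Lemma connected_neq0 Y : connected Y -> dom Y !=set0.
Proof.
move=> [C YC]; have [x Yx _] : components Y C by rewrite YC.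
by exists x.
Qed.

Lemma connected_clos Y x y : connected Y -> dom Y x -> dom Y y ->
  Relation_Operators.clos_refl_sym_trans U (fun u v => rho Y (u, v)) x y.
Proof.
move=> [C YC] Yx Yy.
have eqC z : dom Y z -> component Y z = C.
  by move=> Yz; have : components Y (component Y z) by [exists z]; rewrite YC.
have : component Y y y by split => //; exact: Relation_Operators.rst_refl.
by rewrite (eqC y) // -(eqC x) // => -[].
Qed.

Lemma condensation_iter Y f n : condensation Y Y f -> condensation Y Y (iter n f).
Proof.
move=> [[fD fR] [_ fI fS]]; elim: n => [|n [[gD gR] [_ gI gS]]].
  by split; split => //= y Yy; exists y.
have SD : set_fun (dom Y) (dom Y) (iter n.+1 f) by move=> x /gD /fD.
split; split => //.
- by move=> x y /gR /fR.
- move=> x y xY yY /= e; apply: gI => //; apply: fI => //.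
    by rewrite inE; apply: gD; rewrite -inE.
  by rewrite inE; apply: gD; rewrite -inE.
- by move=> z /fS[y /gS[x Yx <-] <-]; exists x.
Qed.

End Morphisms.

(** * Condensations of a disjoint union *)

Section UnionCondensation.
Variables (U I : Type) (X : I -> structure U).
Hypothesis Xdisj : pairwise_disjoint X.
Hypothesis Xconn : forall i, connected (X i).

Lemma dom_index_inj i j x : dom (X i) x -> dom (X j) x -> i = j.
Proof. by move=> ix jx; apply: Xdisj => //; exists x. Qed.

Lemma rho_union_index i x y : dom (X i) x -> union_rho X (x, y) ->
  rho (X i) (x, y).
Proof.
move=> ix [j _ jxy]; have [/= jx _] := rho_sub jxy.
by rewrite (dom_index_inj ix jx).
Qed.

Lemma union_homomorphism_index f : homomorphism (union X) (union X) f ->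
  exists g : I -> I, forall i, homomorphism (X i) (X (g i)) f.
Proof.
move=> [fD fR].
suff /choice[g gP] : forall i, exists j, homomorphism (X i) (X j) f by exists g.
move=> i; have [x0 ix0] := connected_neq0 (Xconn i).
have [j _ jfx0] : union_dom X (f x0) by apply: fD; exists i.
have fj : set_fun (dom (X i)) (dom (X j)) f.
  move=> y iy; have := connected_clos (Xconn i) ix0 iy.
  (* Whether a point is mapped into [X j] is invariant along edges, because the image of an edge
     lies inside a single structure of the family. *)
  suff step u v : Relation_Operators.clos_refl_sym_trans U
      (fun u v => rho (X i) (u, v)) u v ->
      dom (X j) (f u) <-> dom (X j) (f v) by move/step => [+ _]; apply.
  elim=> {u v} [u v iuv|//|u v _ [uv vu]|u v w _ [uv vu] _ [vw wv]].
  - have [k _ kfuv] : union_rho X (f u, f v) by apply: fR; exists i.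
    have [/= ku kv] := rho_sub kfuv.
    by split=> [/(dom_index_inj ku) <-|/(dom_index_inj kv) <-].
  - by split.
  - by split=> [/uv|/wv].
exists j; split=> // x y ixy; have [/= ix _] := rho_sub ixy.
by apply: rho_union_index; [apply: fj | apply: fR; exists i].
Qed.

Section PeriodicIndex.
Variables (f : U -> U) (g : I -> I).
Hypothesis fcond : condensation (union X) (union X) f.
Hypothesis fg : forall i, homomorphism (X i) (X (g i)) f.

Lemma index_surj j : exists i, g i = j.
Proof.
have [_ [_ _ fS]] := fcond; have [y jy] := connected_neq0 (Xconn j).
have [|x [i _ ix] fx] := fS y; first by exists j.
by exists i; apply: (@dom_index_inj _ _ y) => //; rewrite -fx; apply: (fg i).1.
Qed.

Lemma index_mono_le i : mono_le (X i) (X (g i)).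
Proof.
exists f; split; first exact: fg.
have [_ [_ fI _]] := fcond => x y; rewrite !inE => ix iy.
by apply: fI; rewrite inE; exists i.
Qed.

Lemma iter_index_homomorphism n i :
  homomorphism (X i) (X (iter n g i)) (iter n f).
Proof.
elim: n => [|n [gD gR]]; first by split.
have [fD fR] := fg (iter n g i).
by split=> [x /gD /fD|x y /gR /fR].
Qed.

Lemma iter_index_condensation n i : injective g -> iter n g i = i ->
  condensation (X i) (X i) (iter n f).
Proof.
move=> gI gi; have fn := iter_index_homomorphism n.
have [_ [_ fI fS]] := condensation_iter n fcond.
have fi : homomorphism (X i) (X i) (iter n f) by rewrite -{2}gi.
split=> //; split; first exact: fi.1.
  by move=> x y; rewrite !inE => ix iy; apply: fI; rewrite inE; exists i.
(* A preimage of [z] in the union might lie in another [X j]; injectivity of the iterates of [g]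
   forces [j = i]. *)
move=> z iz; have [|x [j _ jx] fx] := fS z; first by exists i.
exists x => //; suff -> : i = j by [].
have ginj : injective (iter n g) by elim: (n) => //= m IHm a b /gI /IHm.
apply: ginj; rewrite gi; apply: (dom_index_inj iz).
by rewrite -fx; apply: (fn j).1.
Qed.

Lemma periodic_index_automorphism : (forall i, reversible (X i)) ->
  (forall i, exists n, iter n.+1 g i = i) -> automorphism (union X) f.
Proof.
move=> Xrev per; have gI := periodic_injective per.
have [[fD fR] fB] := fcond; split=> // x y [i _ ix] [i' _ iy].
split; first exact: fR.
move=> /(rho_union_index ((fg i).1 _ ix)) fxy.
(* The edge between [f x] and [f y] puts both in [X (g i)], so [g i = g i']. *)
have ii' : i = i'.
  apply: gI; apply: (@dom_index_inj _ _ (f y)); last exact: (fg i').1.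
  by have [] := rho_sub fxy.
rewrite -{}ii' in iy; have [n gi] := per i.
have [_ fn] := Xrev i _ (iter_index_condensation gI gi).
exists i => //; apply/fn => //.
(* Pushing this edge [n] steps further brings it back to [X i], as an edge between the images of [x]
   and [y] under the automorphism [iter n.+1 f]. *)
have [_ hR] := iter_index_homomorphism n (g i).
by have := hR _ _ fxy; rewrite -!iterSr gi.
Qed.

End PeriodicIndex.

Lemma union_reversible (W : wf_relation) (theta : range X -> W) :
  (forall i, reversible (X i)) -> monotone_class theta ->
  (forall a, range theta a -> ~ exists s, omega_star_seq X (level theta a) s) ->
  reversible (union X).
Proof.
move=> Xrev mono noseq f fcond; have [fhom _] := fcond.
have [g fg] := union_homomorphism_index fhom.
apply: (periodic_index_automorphism fcond fg Xrev).
pose le i j := mono_le (X i) (X j); pose t i := theta (Defs.family_mem X i).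
refine (@increasing_surjection_periodic I le W t _ _ _ _ g _ _).
- by move=> i; exact: mono_le_refl.
- by move=> i j k; exact: mono_le_trans.
- by move=> i j ij; exact: mono.
- move=> a [s [sI sa sle]]; apply: (@noseq a); last by exists s; split.
  (* The first term of the sequence witnesses that [a] is a value of [theta]. *)
  by rewrite -(sa 0); exists (Defs.family_mem X (s 0)).
- exact: index_surj fcond fg.
- exact: index_mono_le fcond fg.
Qed.

End UnionCondensation.

Lemma finite_set_no_injection (T : Type) (J : set T) (s : nat -> T) :
  finite_set J -> injective s -> ~ forall k, J (s k).
Proof.
move=> Jfin sI Js; apply: infinite_nat.
have -> : [set: nat] = s @^-1` J by apply/seteqP; split=> k _ /=.
by apply: finite_preimage => // k l _ _; exact: sI.
Qed.

Theorem theorem4p1 (U I : Type) (X : I -> structure U)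
    (Xdisj : pairwise_disjoint X)
    (Xconn : forall i, connected (X i))
    (Xrev : forall i, reversible (X i)) :
  ((exists (W : wf_relation) (theta : range X -> W),
      monotone_class theta /\
      forall a, range theta a ->
        ~ exists s, omega_star_seq X (level theta a) s) ->
   reversible (union X)) /\
  ((exists (W : wf_relation) (theta : range X -> W),
      monotone_class theta /\
      forall a, range theta a -> finite_set (level theta a)) ->
   reversible (union X)).
Proof.
split=> -[W [theta [mono lev]]]; apply: (union_reversible _ _ Xrev mono) => //.
move=> a /lev Jfin [s [sI sJ _]]; exact: finite_set_no_injection Jfin sI sJ.
Qed.
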